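(* In general dimension $n$: (i) There exist convex bodies $K,L\subset\mathbb{R}^n$ such that for every $\xi\in S^{n-1}$ there exists a rotation $\varphi_\xi\in SO(n-1,\xi^\perp)$ with $\varphi_\xi(K\cap\xi^\perp)\subseteq L\cap\xi^\perp$, but there is no $\psi\in SO(n)$ with $\psi(K)\subseteq L$. (ii) There exist convex bodies $K,L\subset\mathbb{R}^n$ such that for every $\xi\in S^{n-1}$ there exists a rotation $\varphi_\xi\in SO(n-1,\xi^\perp)$ with $\varphi_\xi(K|\xi^\perp)\subseteq L|\xi^\perp$, but there is no $\psi\in SO(n)$ with $\psi(K)\subseteq L$.
   Context: A convex body is a compact convex set in $\mathbb{R}^n$ that equals the closure of its non-empty interior. $S^{n-1}$ is the unit sphere of $\mathbb{R}^n$ and $SO(n)$ is the group of rotations of $\mathbb{R}^n$. For a unit vector $\xi\in S^{n-1}$, $\xi^\perp=\{x\in\mathbb{R}^n: x\cdot\xi=0\}$; $K\cap\xi^\perp$ is the section of $K$ by $\xi^\perp$ and $K|\xi^\perp$ is the orthogonal projection of $K$ onto $\xi^\perp$. $SO(n-1,\xi^\perp)$ is the group of rotations of the hyperplane $\xi^\perp$ around the origin (equivalently, restrictions to $\xi^\perp$ of rotations $\Phi\in SO(n)$ with $\Phi(\xi)=\xi$). The source states the result for ''general dimension $n$'' and does not specify a range of $n$; for $n=2$ the group $SO(n-1,\xi^\perp)$ is trivial.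
   Formalization: The formal statement takes ''general dimension n'' to mean n ≥ 3; for n = 2 the group SO(n-1, ξ^⊥) is trivial and both (i) and (ii) are false, since the containments then force K ⊆ L (the degenerate case n = 1 is also left out). *)

(* Defs.v *)
From mathcomp Require Import all_boot all_order all_algebra.
From mathcomp Require Import all_classical all_reals all_analysis.

Set Implicit Arguments.
Unset Strict Implicit.
Unset Printing Implicit Defensive.

Import GRing.Theory Num.Theory.
Import numFieldNormedType.Exports.

Local Open Scope classical_set_scope.
Local Open Scope ring_scope.

(* Points of R^n are row vectors 'rV[R]_n. The library puts the sup norm on
   them; it is used only through its topology, which is the Euclidean one.
   All metric notions below come from the Euclidean inner product [dot]. *)

Definition dot (R : realType) (n : nat) (x y : 'rV[R]_n) : R :=
  \sum_(i < n) x 0 i * y 0 i.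

Definition unit_sphere (R : realType) (n : nat) : set 'rV[R]_n :=
  [set xi | dot xi xi = 1].

Definition perp (R : realType) (n : nat) (xi : 'rV[R]_n) : set 'rV[R]_n :=
  [set x | dot x xi = 0].

Definition convex_body (R : realType) (n : nat) (K : set 'rV[R]_n) : Prop :=
  [/\ convex_set K, compact K, interior K !=set0 & K = closure (interior K)].

Definition SO (R : realType) (n : nat) : set 'M[R]_n :=
  [set A | A *m A^T = 1%:M /\ \det A = 1].

(* Vectors being rows, the rotation with matrix A is x |-> x *m A. *)
Definition rotate_by (R : realType) (n : nat) (A : 'M[R]_n) (x : 'rV[R]_n) :
  'rV[R]_n := x *m A.

(* SO(n-1, xi^perp) is represented by the rotations of R^n that fix xi; such
   a rotation preserves [perp xi], and is determined by its restriction to it. *)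
Definition SO_perp (R : realType) (n : nat) (xi : 'rV[R]_n) : set 'M[R]_n :=
  [set A | SO A /\ rotate_by A xi = xi].

Definition section (R : realType) (n : nat) (K : set 'rV[R]_n)
  (xi : 'rV[R]_n) : set 'rV[R]_n := K `&` perp xi.

(* The formula is the orthogonal projection onto [perp xi] for unit xi. *)
Definition projection (R : realType) (n : nat) (K : set 'rV[R]_n)
  (xi : 'rV[R]_n) : set 'rV[R]_n :=
  (fun x : 'rV[R]_n => x - dot x xi *: xi) @` K.

(* Main.v *)
Require Import Defs.
From mathcomp Require Import all_boot all_order all_algebra.
From mathcomp Require Import all_classical all_reals all_analysis.
From mathcomp Require Import ring lra.
Import Order.TTheory GRing.Theory Num.Theory.
Import numFieldNormedType.Exports.
Local Open Scope classical_set_scope.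
Local Open Scope ring_scope.

(** The same pair of bodies serves for (i) and (ii).  Let Z consist of the n
    basis vectors and of the unit vector opposite to their sum, and let C be the
    spherical cap of unit vectors p with p . q >= c, for a fixed unit vector q.
    For h slightly below 1, K is essentially the convex hull of the ball of
    radius h and Z (a ball with n + 1 spikes), while L is the unit ball cut at
    height h in every direction of C.

    Every cap congruent to C meets Z, because Z spans R^n positively, so some
    spike of psi(K) always sticks out of L.  In a hyperplane H, however, only the
    spikes almost contained in H are longer than h after projection, and these
    do not span H positively: some unit vector w of H makes an angle of at least
    pi/2 with all of them.  Rotating w onto the direction of the projection of q
    keeps all remaining spikes away from C, so that the projection of K, and a
    fortiori its section, goes into the section of L, and hence also into the
    projection of L. *)

(** * The Euclidean inner product *)

Section Dot.
Context {R : realType} {n : nat}.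
Implicit Types (x y z : 'rV[R]_n) (a : R).

Lemma dotE x y : dot x y = (x *m y^T) 0 0.
Proof. by rewrite mxE; apply: eq_bigr => i _; rewrite mxE. Qed.

Lemma dotC x y : dot x y = dot y x.
Proof. by apply: eq_bigr => i _; rewrite mulrC. Qed.

Lemma dotDl x y z : dot (x + y) z = dot x z + dot y z.
Proof. by rewrite !dotE mulmxDl mxE. Qed.

Lemma dotZl a x y : dot (a *: x) y = a * dot x y.
Proof. by rewrite !dotE -scalemxAl mxE. Qed.

Lemma dotNl x y : dot (- x) y = - dot x y.
Proof. by rewrite -scaleN1r dotZl mulN1r. Qed.

Lemma dotBl x y z : dot (x - y) z = dot x z - dot y z.
Proof. by rewrite dotDl dotNl. Qed.

Lemma dotDr x y z : dot z (x + y) = dot z x + dot z y.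
Proof. by rewrite !(dotC z) dotDl. Qed.

Lemma dotZr a x y : dot x (a *: y) = a * dot x y.
Proof. by rewrite !(dotC x) dotZl. Qed.

Lemma dotBr x y z : dot z (x - y) = dot z x - dot z y.
Proof. by rewrite !(dotC z) dotBl. Qed.

Lemma dot0l x : dot 0 x = 0.
Proof. by rewrite dotE mul0mx mxE. Qed.

Lemma dot_ge0 x : 0 <= dot x x.
Proof. by apply: sumr_ge0 => i _; rewrite -expr2 sqr_ge0. Qed.

Lemma dot_eq0 x : (dot x x == 0) = (x == 0).
Proof.
apply/eqP/eqP => [x0|->]; last exact: dot0l.
apply/rowP => i; rewrite mxE.
have /(_ i isT)/eqP : forall j : 'I_n, true -> x 0 j ^+ 2 = 0.
  apply: psumr_eq0P => [j _|]; first exact: sqr_ge0.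
  by rewrite -[RHS]x0; apply: eq_bigr => j _; rewrite expr2.
by rewrite sqrf_eq0 => /eqP.
Qed.

Lemma cauchy_schwarz x y : dot x y ^+ 2 <= dot x x * dot y y.
Proof.
have [->|y0] := eqVneq y 0; first by rewrite dotC !dot0l expr2 mul0r mulr0.
have yy : 0 < dot y y by rewrite lt_neqAle eq_sym dot_eq0 y0 dot_ge0.
have := dot_ge0 (dot y y *: x - dot x y *: y).
rewrite !dotBl !dotBr !dotZl !dotZr (dotC y x) => H.
rewrite -subr_ge0 -(pmulr_rge0 _ yy).
by apply: le_trans H _; rewrite le_eqVlt; apply/orP; left; apply/eqP; ring.
Qed.

Lemma dot_le_mul a b x y : 0 <= a -> 0 <= b ->
  dot x x <= a ^+ 2 -> dot y y <= b ^+ 2 -> dot x y <= a * b.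
Proof.
move=> a0 b0 xa yb; rewrite (le_trans (ler_norm _)) // -ler_sqr ?nnegrE ?mulr_ge0 //.
rewrite real_normK ?num_real // exprMn (le_trans (cauchy_schwarz _ _)) //.
by rewrite ler_pM ?dot_ge0.
Qed.

Lemma dot_mulmx (A : 'M[R]_n) x y : dot (x *m A) y = dot x (y *m A^T).
Proof. by rewrite !dotE trmx_mul trmxK mulmxA. Qed.

Lemma dot_continuous (f g : 'rV[R]_n -> 'rV[R]_n) :
  continuous f -> continuous g -> continuous (fun x => dot (f x) (g x)).
Proof.
move=> cf cg x; rewrite /dot.
have cc (k : 'rV[R]_n -> 'rV[R]_n) i : continuous k ->
    {for x, continuous (fun z => k z 0 i)}.
  move=> ck; pose e (M : 'rV[R]_n) : R := M 0 i.
  pose ce := @coord_continuous R 1 n 0 i (k x).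
  exact: (@continuous_comp _ _ _ k e x (ck x) ce).
apply: (cvg_big add_continuous (nbhs_filter x)) => i _.
exact: (continuousM (cc _ i cf) (cc _ i cg)).
Qed.

End Dot.

(** * Polar sets within the unit ball, and why they are convex bodies *)

Section BallPolar.
Context {R : realType} {n : nat}.
Implicit Types (x y z : 'rV[R]_n) (A : set 'rV[R]_n) (h : R).

(** Both bodies have this form: the unit ball cut by half-spaces. Applied twice it acts as a
    bipolar: for [0 <= h <= 1] the result contains the ball of radius [h] and all vectors of [A] of
    length at most 1, so it stands in for their convex hull. *)
Definition ball_polar h A : set 'rV[R]_n :=
  [set x | dot x x <= 1 /\ forall a, A a -> dot x a <= h].

Lemma convex_comb_ball_polar h A x y (t : R) : 0 <= t <= 1 ->
  ball_polar h A x -> ball_polar h A y -> ball_polar h A (t *: x + (1 - t) *: y).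
Proof.
move=> /andP[t0 t1] [x1 xA] [y1 yA]; split.
  have xy : dot x y <= 1 by rewrite -[1]mulr1 dot_le_mul // expr1n.
  (* With the middle one doubled, the three products add up to 1 minus the squared length of the
     combination. *)
  have := mulr_ge0 (mulr_ge0 t0 t0) (_ : 0 <= 1 - dot x x).
  have := mulr_ge0 (mulr_ge0 t0 (_ : 0 <= 1 - t)) (_ : 0 <= 1 - dot x y).
  have := mulr_ge0 (sqr_ge0 (1 - t)) (_ : 0 <= 1 - dot y y).
  rewrite !subr_ge0 dotDl !dotDr !dotZl !dotZr (dotC y x).
  by move=> /(_ y1) H1 /(_ t1 xy) H2 /(_ x1) H3; nra.
move=> a Aa; have := xA a Aa; have := yA a Aa.
rewrite dotDl !dotZl; nra.
Qed.

Lemma convex_ball_polar h A : convex_set (ball_polar h A).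
Proof.
move=> x y l; rewrite !inE => xA yA.
apply: convex_comb_ball_polar => //; apply/andP; split; [exact: ge0|exact: le1].
Qed.

Lemma closed_ball_polar h A : closed (ball_polar h A).
Proof.
have -> : ball_polar h A = [set x | dot x x <= 1] `&`
    \bigcap_(a in A) [set x | dot x a <= h] by [].
apply: closedI; last apply: closed_bigI => a _.
- apply: (@preimage_closed _ _ (fun x : 'rV[R]_n => dot x x) [set t | t <= 1]).
    by move=> x _; apply: dot_continuous => z.
  exact: closed_le.
- apply: (@preimage_closed _ _ (fun x : 'rV[R]_n => dot x a) [set t | t <= h]).
    by move=> x _; apply: (@dot_continuous _ _ id (fun=> a));
      [move=> z; exact: cvg_id | exact: cst_continuous].
  exact: closed_le.
Qed.

Lemma compact_ball_polar h A : compact (ball_polar h A).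
Proof.
apply: bounded_closed_compact; last exact: closed_ball_polar.
exists 1; split => // M M1 x [x1 _].
(* The norm is the sup norm, and each squared coordinate is at most [dot x x]. *)
rewrite /= [leLHS]/Num.Def.normr /= mx_normrE.
apply/bigmax_leP; split => [|[i j] _ /=].
  by rewrite ltW // (lt_trans _ M1).
rewrite (ord1 i) (le_trans _ (ltW M1)) // -(@ler_sqr _ `|_|) ?nnegrE // expr1n.
rewrite real_normK ?num_real // (le_trans _ x1) // /dot (bigD1 j) //= expr2.
by rewrite lerDl sumr_ge0 // => k _; rewrite -expr2 sqr_ge0.
Qed.

Lemma small_ball_polar h A x : 0 <= h <= 1 -> (forall a, A a -> dot a a <= 1) ->
  dot x x <= h ^+ 2 -> ball_polar h A x.
Proof.
move=> /andP[h0 h1] A1 xh; split; first by rewrite (le_trans xh) // expr_le1.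
by move=> a Aa; rewrite -[h]mulr1 dot_le_mul // expr1n A1.
Qed.

(** The body contains the ball of radius [h] about 0, so by convexity it contains the ball of radius
    [(1 - t) * h] about [t *: x]. *)
Lemma interior_scaled_ball_polar h A x (t : R) :
  0 < h <= 1 -> (forall a, A a -> dot a a <= 1) -> 0 <= t < 1 ->
  ball_polar h A x -> (ball_polar h A)^° (t *: x).
Proof.
move=> /andP[h0 h1] A1 /andP[t0 t1] Ax.
have s0 : 0 < 1 - t by lra.
pose f (y : 'rV[R]_n) := dot (y - t *: x) (y - t *: x).
have fc : continuous f.
  suff c : continuous (fun y => y - t *: x) by exact: dot_continuous.
  by move=> y; exact: (cvgB (@cvg_id _ (nbhs y)) (@cst_continuous _ _ (t *: x) y)).
apply: (@filterS _ _ _ (f @^-1` [set r | r < ((1 - t) * h) ^+ 2])) => [y fy|].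
  have -> : y = t *: x + (1 - t) *: ((1 - t)^-1 *: (y - t *: x)).
    by rewrite scalerA mulfV ?gt_eqF // scale1r addrC subrK.
  apply: convex_comb_ball_polar => //; first by rewrite t0 ltW.
  apply: small_ball_polar => //; first by rewrite (ltW h0).
  rewrite dotZl dotZr mulrA -expr2 -[leRHS](mulKf (x := (1 - t) ^+ 2)).
    by rewrite exprVn -exprMn ler_pM2l ?invr_gt0 ?exprn_gt0 // ltW.
  by rewrite expf_neq0 // gt_eqF.
have : open (f @^-1` [set r | r < ((1 - t) * h) ^+ 2]).
  by apply: open_comp; [move=> ? _; exact: fc | exact: open_lt].
by rewrite openE; apply; rewrite /f /= subrr dot0l exprn_gt0 // mulr_gt0.
Qed.

Lemma convex_body_ball_polar h A : 0 < h <= 1 ->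
  (forall a, A a -> dot a a <= 1) -> convex_body (ball_polar h A).
Proof.
move=> h01 A1; have [h0 h1] := andP h01.
split; [exact: convex_ball_polar|exact: compact_ball_polar| |].
  exists (0 *: 0); apply: interior_scaled_ball_polar => //.
    by rewrite lexx ltr01.
  by apply: small_ball_polar; rewrite ?(ltW h0) // dot0l sqr_ge0.
apply/seteqP; split; last first.
  apply: (subset_trans (closure_subset (@interior_subset _ _))).
  by rewrite -(closure_id _).1 //; exact: closed_ball_polar.
move=> x Ax B Bx.
(* The point [x] is the limit of the interior points [t *: x] as [t] tends to 1 from below. *)
have sc : (fun t : R => t *: x) @ 1^'- --> x.
  rewrite -[X in _ --> X]scale1r; apply: cvg_at_left_filter.
  by apply: cvgZr_tmp; exact: cvg_id.
have : \forall t \near (1 : R)^'-, B (t *: x) /\ 0 <= t < 1.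
  near=> t; split; first by near: t; exact: sc.
  rewrite ltW /=; last by near: t; exact: nbhs_left_gt.
  by near: t; exact: nbhs_left_lt.
move=> /filter_ex[t [Bt t01]]; exists (t *: x); split => //.
exact: interior_scaled_ball_polar.
Unshelve. all: by end_near. Qed.

End BallPolar.

(** * Reflections, and transitivity of the rotations fixing a vector *)

Section Householder.
Context {R : realType} {n : nat}.
Implicit Types (u v w x y : 'rV[R]_n).

(** The same block matrix is factored into block triangular matrices in two ways. *)
Lemma det_sub_rank1 u w : \det (1%:M - u^T *m w) = 1 - dot w u.
Proof.
have e1 : block_mx 1%:M w u^T 1%:M =
    block_mx 1%:M 0 u^T 1%:M *m block_mx (1%:M : 'M[R]_1) w 0 (1%:M - u^T *m w).
  by rewrite mulmx_block ?(mul1mx, mulmx1, mul0mx, mulmx0, addr0) addrC subrK.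
have e2 : block_mx 1%:M w u^T 1%:M =
    block_mx (1%:M - w *m u^T) w 0 1%:M *m block_mx (1%:M : 'M[R]_1) 0 u^T 1%:M.
  by rewrite mulmx_block ?(mul1mx, mulmx1, mul0mx, mulmx0, add0r) subrK.
have := congr1 determinant e1; rewrite e2 !det_mulmx !det_ublock !det_lblock !det1.
by rewrite !mulr1 !mul1r => <-; rewrite det_mx11 !mxE dotE mxE.
Qed.

Definition householder v : 'M[R]_n :=
  1%:M - (2 / dot v v) *: v^T *m v.

Lemma mulmx_householder v x :
  x *m householder v = x - (2 * dot x v / dot v v) *: v.
Proof.
rewrite /householder mulmxBr mulmx1; congr (_ - _).
rewrite -scalemxAl -scalemxAr mulmxA [x *m v^T]mx11_scalar mul_scalar_mx -dotE.
by rewrite scalerA mulrAC.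
Qed.

Lemma mulmx_householder_orth v x : dot x v = 0 -> x *m householder v = x.
Proof. by move=> xv; rewrite mulmx_householder xv mulr0 mul0r scale0r subr0. Qed.

Lemma det_householder v : v != 0 -> \det (householder v) = -1.
Proof.
move=> v0; rewrite /householder -linearZ /= det_sub_rank1 dotZr.
rewrite divfK; last by rewrite dot_eq0.
by ring.
Qed.

Lemma householder_orthogonal v : v != 0 -> householder v *m (householder v)^T = 1%:M.
Proof.
move=> v0; have -> : (householder v)^T = householder v.
  by rewrite /householder linearB /= trmx1 trmx_mul linearZ /= trmxK -scalemxAr -scalemxAl.
apply/row_matrixP => i; rewrite !rowE mulmxA mulmx1 !mulmx_householder.
set x := delta_mx _ _; rewrite dotBl dotZl divfK; last by rewrite dot_eq0.
rewrite (_ : 2 * (_ - _) / _ = - (2 * dot x v / dot v v)); last by ring.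
by rewrite scaleNr opprK subrK.
Qed.

Lemma householder_swap u w : dot u u = dot w w -> w != u ->
  w *m householder (w - u) = u.
Proof.
move=> uw wu; rewrite mulmx_householder.
have D0 : dot (w - u) (w - u) != 0 by rewrite dot_eq0 subr_eq0.
rewrite (_ : 2 * _ = dot (w - u) (w - u)) ?divff // ?scale1r.
  by rewrite opprB addrC subrK.
by rewrite !dotBl !dotBr (dotC u w) uw; ring.
Qed.

Lemma exists_orthogonal2 u w : (3 <= n)%N ->
  exists x, [/\ x != 0, dot x u = 0 & dot x w = 0].
Proof.
move=> n3; pose M := row_mx u^T w^T.
have : kermx M != 0.
  rewrite kermx_eq0 /row_free; apply/negP => /eqP rM.
  by have := rank_leq_col M; rewrite rM leqNgt n3.
rewrite -nz_row_eq0 => xn0; exists (nz_row (kermx M)).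
have : (nz_row (kermx M) <= kermx M)%MS by exact: nz_row_sub.
move=> /sub_kermxP; rewrite /M mul_mx_row -[0]row_mx0 => /eq_row_mx[xu xw].
by split; rewrite // dotE (xu, xw) mxE.
Qed.

(** The reflection along [w - u] takes [w] to [u] and fixes [xi]; a second reflection, along a
    vector orthogonal to both [u] and [xi], restores determinant 1. That vector exists because
    [n >= 3]. *)
Lemma SO_perp_transitive (xi : 'rV[R]_n) u w : (3 <= n)%N ->
  dot u u = dot w w -> dot u xi = 0 -> dot w xi = 0 ->
  exists2 A, SO_perp xi A & w *m A = u.
Proof.
move=> n3 uw uxi wxi; have [->|wu] := eqVneq w u.
  exists 1%:M; last by rewrite mulmx1.
  by split; [split; rewrite ?trmx1 ?mulmx1 ?det1 | rewrite /rotate_by mulmx1].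
have [v [v0 vu vxi]] := exists_orthogonal2 u xi n3.
exists (householder (w - u) *m householder v).
  split.
    split; last by rewrite det_mulmx !det_householder ?subr_eq0 // mulrNN mulr1.
    rewrite trmx_mul mulmxA -[X in X *m _]mulmxA householder_orthogonal //.
    by rewrite mulmx1 householder_orthogonal // subr_eq0.
  rewrite /rotate_by mulmxA (mulmx_householder_orth (w - u)); last first.
    by rewrite dotBr !(dotC xi) uxi wxi subrr.
  by rewrite mulmx_householder_orth // dotC.
by rewrite mulmxA householder_swap // mulmx_householder_orth // dotC.
Qed.

End Householder.

(** * The directions of the spikes *)

Section Directions.
Context {R : realType} {n : nat}.
Implicit Types (x y z xi : 'rV[R]_n).

Definition directions : set 'rV[R]_n :=
  [set z | (exists i, z = delta_mx 0 i) \/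
           z = - (Num.sqrt n%:R)^-1 *: const_mx 1].

Lemma dot_delta x i : dot x (delta_mx 0 i) = x 0 i.
Proof.
rewrite /dot (bigD1 i) //= big1 ?addr0 => [|j ji]; first by rewrite mxE !eqxx mulr1.
by rewrite mxE (negPf ji) andbF mulr0.
Qed.

Lemma dot_const1 x : dot x (const_mx 1) = \sum_i x 0 i.
Proof. by apply: eq_bigr => i _; rewrite mxE mulr1. Qed.

Context (n3 : (3 <= n)%N).
Local Notation N := (n%:R : R).

Let N_ge3 : 3 <= N. Proof. by rewrite (ler_nat _ 3). Qed.

Let sqrtN : [/\ 0 < Num.sqrt N, Num.sqrt N ^+ 2 = N & Num.sqrt N <= N].
Proof.
have N3 := N_ge3; have N0 : 0 < N by lra.
split; [by rewrite sqrtr_gt0 | by rewrite sqr_sqrtr // ltW |].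
rewrite -ler_sqr ?nnegrE ?sqrtr_ge0 ?(ltW N0) // sqr_sqrtr ?(ltW N0) // expr2.
by rewrite ler_pMr //; lra.
Qed.

Lemma directions_unit z : directions z -> dot z z = 1.
Proof.
move=> [[i ->]|->]; first by rewrite dot_delta mxE !eqxx.
have [s0 sN _] := sqrtN.
rewrite dotZl dotZr dot_const1 (eq_bigr (fun=> 1)) => [|i _]; last by rewrite mxE.
rewrite sumr_const card_ord -[X in _ * (_ * X)]sN.
by field; rewrite gt_eqF.
Qed.

(** Quantitative positive spanning: if all these inner products were below [c = 1/(4n)], every
    coordinate would be below [c] and the coordinate sum above -1/4. *)
Lemma directions_net x : dot x x = 1 ->
  exists2 z, directions z & (4 * N)^-1 <= dot x z.
Proof.
move=> x1; apply: contrapT => /forall2NP H.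
have [s0 sN sleN] := sqrtN.
have N3 := N_ge3; have N0 : 0 < N by lra.
set c := (4 * N)^-1 in H.
have c0 : 0 < c by rewrite invr_gt0 mulr_gt0.
have cN : c * N = 4^-1 by rewrite /c; field; rewrite gt_eqF.
have xc i : x 0 i < c.
  case: (H (delta_mx 0 i)) => [[]|/negP]; first by left; exists i.
  by rewrite dot_delta -ltNge.
have S : - (\sum_i x 0 i) < c * N.
  case: (H (- (Num.sqrt n%:R)^-1 *: const_mx 1)) => [[]|/negP]; first by right.
  rewrite dotZr dot_const1 -ltNge mulNr -mulrN mulrC ltr_pdivrMr // => h.
  by rewrite (lt_le_trans h) // ler_pM2l.
(* Termwise: a square is at most the coordinate, hence at most [c], on [[0, c)], and at most minus
   the coordinate on [[-1, 0)]. Summing yields 1 < 1/2 + 1/4. *)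
have : \sum_i x 0 i * x 0 i <= \sum_(i < n) (2 * c - x 0 i).
  apply: ler_sum => i _; have xic := xc i.
  have : x 0 i ^+ 2 <= 1.
    rewrite -x1 /dot (bigD1 i) //= expr2 lerDl sumr_ge0 // => j _.
    by rewrite -expr2 sqr_ge0.
  rewrite -[X in _ <= X](expr1n _ 2) -real_normK ?num_real // ler_sqr ?nnegrE //.
  have c1 : c <= 1 by rewrite /c invf_le1 ?mulr_gt0 //; lra.
  rewrite ler_norml => /andP[xm xp]; have [xi0|xi0] := leP 0 (x 0 i); nra.
rewrite -[X in X <= _]/(dot x x) x1 sumrB.
have -> : \sum_(i < n) 2 * c = 2 * (c * N).
  by rewrite sumr_const card_ord -[LHS]mulr_natr mulrA.
by rewrite cN; move: S; rewrite cN; lra.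
Qed.

Lemma exists_large_coord xi : dot xi xi = 1 -> exists j, N^-1 <= `|xi 0 j|.
Proof.
move=> x1; apply: contrapT => /forallNP H.
have N3 := N_ge3; have N0 : 0 < N by lra.
have : dot xi xi <= \sum_(i < n) N^-1 ^+ 2.
  apply: ler_sum => i _; rewrite -expr2 -real_normK ?num_real //.
  rewrite ler_sqr ?nnegrE ?invr_ge0 ?(ltW N0) //.
  by have /negP := H i; rewrite -ltNge => /ltW.
rewrite x1 sumr_const card_ord -[leRHS]mulr_natr expr2 -mulrA mulVf ?gt_eqF // mulr1.
rewrite invf_ge1 //; lra.
Qed.

(* A coordinate [j] with [xi_j] large is invisible to directions close to
   [perp xi], so a vector supported on [j] and another coordinate only has to
   satisfy the sign conditions that survive. *)
Lemma exists_obtuse_direction xi : dot xi xi = 1 ->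
  exists w, [/\ w != 0, dot w xi = 0 &
    forall z, directions z -> `|dot z xi| <= (16 * N ^+ 2)^-1 -> dot w z <= 0].
Proof.
move=> x1; have [s0 sN sleN] := sqrtN.
have N3 := N_ge3; have N0 : 0 < N by lra.
set d := (16 * N ^+ 2)^-1.
have d0 : 0 < d by rewrite invr_gt0 mulr_gt0 // exprn_gt0.
have dN : d * N = (16 * N)^-1 by rewrite /d; field; rewrite gt_eqF.
have V0 : 0 < N^-1 by rewrite invr_gt0.
have dNV : d * N = N^-1 / 16 by rewrite dN; field; rewrite gt_eqF.
have dV : d < N^-1 by nra.
have [j xij] := exists_large_coord _ x1.
have xij0 : xi 0 j != 0 by rewrite -normr_gt0; lra.
have [S|S] := leP `|dot (- (Num.sqrt n%:R)^-1 *: const_mx 1) xi| d.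
  (* The diagonal direction is nearly in [perp xi]. Were [xi 0 j] the only large coordinate, it
     would be the small total sum minus small terms, at most [2 * d * N = 1/(8N)]. *)
  have [l lj xil] : exists2 l, l != j & d < `|xi 0 l|.
    apply: contrapT => /forall2NP H.
    have Hd l : l != j -> `|xi 0 l| <= d.
      by move=> lj; case: (H l) => // /negP; rewrite -leNgt.
    have sumd : `|\sum_i xi 0 i| <= d * N.
      move: S; rewrite dotC dotZr dot_const1 normrM normrN.
      rewrite (gtr0_norm (x := _^-1)) ?invr_gt0 //.
      rewrite mulrC ler_pdivrMr // => /le_trans; apply; by rewrite ler_pM2l.
    have sumj : \sum_(i < n | i != j) `|xi 0 i| <= d * N.
      apply: (@le_trans _ _ (\sum_(i < n | i != j) d)).
        by apply: ler_sum => i /Hd.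
      apply: (@le_trans _ _ (\sum_(i < n) d)).
        by rewrite [leRHS](bigD1 j) //= lerDr ltW.
      by rewrite sumr_const card_ord mulr_natr.
    have : `|xi 0 j| <= d * N + d * N.
      have -> : xi 0 j = \sum_i xi 0 i - \sum_(i < n | i != j) xi 0 i.
        by rewrite (bigD1 j) //= addrK.
      rewrite (le_trans (ler_normB _ _)) // lerD //.
      by rewrite (le_trans (ler_norm_sum _ _ _)).
    by rewrite dNV; lra.
  (* The witness is supported on [j] and [l], whose basis vectors are both far from [perp xi]; only
     the diagonal direction remains, and [sg] makes the coordinate sum nonnegative. *)
  have [sg sgd sgle] : exists2 sg : R, sg != 0 & 0 <= sg * (xi 0 l - xi 0 j).
    by have [le|le] := leP (xi 0 j) (xi 0 l); [exists 1|exists (-1)];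
       rewrite ?oppr_eq0 ?oner_eq0 //; lra.
  have xil0 : xi 0 l != 0 by rewrite -normr_gt0; lra.
  exists (sg *: (xi 0 l *: delta_mx 0 j - xi 0 j *: delta_mx 0 l)); split.
  - apply/eqP => /rowP/(_ j); rewrite !mxE !eqxx eq_sym (negPf lj) /= => /eqP.
    by rewrite mulr1 mulr0 subr0 mulf_eq0 (negPf sgd) (negPf xil0).
  - rewrite dotC dotZr dotBr !dotZr !dot_delta; ring.
  - move=> z [[i ->]|->].
      rewrite dotC dot_delta dot_delta => xii.
      have ij : i != j by apply: contraTneq xii => ->; rewrite -ltNge; lra.
      have il : i != l by apply: contraTneq xii => ->; rewrite -ltNge.
      by rewrite !mxE (negPf ij) (negPf il) !mulr0 subr0 mulr0.
    move=> _; rewrite dotZr dotZl dotBl !dotZl mulNr oppr_le0.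
    have c1 (k : 'I_n) : dot (delta_mx 0 k) (const_mx 1) = 1 :> R.
      by rewrite dotC dot_delta mxE.
    by rewrite !c1 !mulr1 mulr_ge0 // invr_ge0 ltW.
(* Here the diagonal direction is far from [perp xi], so only basis vectors other than that of [j]
   matter. *)
have [k kj] : exists k : 'I_n, k != j.
  have : (0 < #|predC1 j|)%N.
    by rewrite cardC1 card_ord -subn1 subn_gt0 (leq_trans _ n3).
  by case/card_gt0P => k; exists k.
exists (- delta_mx 0 k + (xi 0 k / xi 0 j) *: delta_mx 0 j); split.
- apply/eqP => /rowP/(_ k); rewrite !mxE !eqxx (negPf kj) /= => /eqP.
  by rewrite mulr0 addr0 oppr_eq0 oner_eq0.
- by rewrite dotC dotDr -scaleN1r !dotZr !dot_delta divfK // mulN1r addNr.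
- move=> z [[i ->]|->]; last by rewrite leNgt S.
  rewrite dotC dot_delta dot_delta => xii.
  have ij : i != j by apply: contraTneq xii => ->; rewrite -ltNge; lra.
  by rewrite !mxE (negPf ij) /= mulr0 addr0 oppr_le0; case: (i == k).
Qed.

End Directions.

(** * Rotating the spikes away from the cap *)

Section Fitting.
Context {R : realType} {n : nat}.
Implicit Types (p q u v w x z xi : 'rV[R]_n).

Lemma dot_shadow v xi : dot xi xi = 1 ->
  dot (v - dot v xi *: xi) (v - dot v xi *: xi) = dot v v - dot v xi ^+ 2.
Proof. by move=> x1; rewrite !dotBl !dotBr !dotZl !dotZr x1 (dotC xi v); ring. Qed.

(* If the shadow of [v] has inner product almost 1 with [z], then [v] and [z]
   both almost lie in [perp xi] and almost coincide, so that [v] makes with [w]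
   an angle of almost at least pi/2, against the lower bound [c]. *)
Lemma shadow_dot_le xi w v z (t b c d : R) :
  dot xi xi = 1 -> dot w w = 1 -> dot w xi = 0 -> dot v v = 1 -> dot z z = 1 ->
  0 < d <= 1 -> 2 * d < c -> 0 <= t <= 1 -> `|b| <= 1 ->
  (`|dot z xi| <= d -> dot w z <= 0) ->
  c <= dot v (t *: w + b *: xi) ->
  dot (v - dot v xi *: xi) z <= 1 - d ^+ 2 / 2.
Proof.
move=> xi1 w1 wxi v1 z1 /andP[d0 d1] dc /andP[t0 t1] b1 wz cv.
rewrite leNgt; apply/negP.
set a := dot v xi; set e := dot z xi in wz *; set g := v - a *: xi => hg.
have gg : dot g g = 1 - a ^+ 2 by rewrite dot_shadow // v1.
have gxi : dot g xi = 0 by rewrite dotBl dotZl xi1 mulr1 subrr.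
have gw : dot g w = dot v w by rewrite dotBl dotZl (dotC xi) wxi mulr0 subr0.
have cs : dot g z ^+ 2 <= (1 - a ^+ 2) * (1 - e ^+ 2).
  have -> : dot g z = dot g (z - e *: xi) by rewrite dotBr dotZr gxi mulr0 subr0.
  by rewrite (le_trans (cauchy_schwarz _ _)) // gg dot_shadow // z1.
clearbody g; have d21 : d ^+ 2 <= 1 by rewrite expr_le1 // ltW.
have d20 : 0 <= d ^+ 2 by exact: sqr_ge0.
(* Together with [cs] this forces both [a ^+ 2] and [e ^+ 2] below [d ^+ 2]. *)
have hd : 1 - d ^+ 2 < dot g z ^+ 2 by nra.
have a0 : 0 <= 1 - a ^+ 2 by rewrite -gg dot_ge0.
have e0 : 0 <= 1 - e ^+ 2 by rewrite -z1 -dot_shadow // dot_ge0.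
have a2 : 0 <= a ^+ 2 by exact: sqr_ge0.
have e2 : 0 <= e ^+ 2 by exact: sqr_ge0.
have small r : r ^+ 2 <= d ^+ 2 -> `|r| <= d.
  by move=> rd; rewrite -ler_sqr ?nnegrE ?(ltW d0) // real_normK ?num_real.
have ad : `|a| <= d by apply: small; nra.
have ed : `|e| <= d by apply: small; nra.
(* Since [dot g g <= 1] and [dot g z > 1 - d ^+ 2 / 2], the squared length of [g - z] is at most
   [d ^+ 2]. Hence [t * dot v w + b * a <= 2 * d < c], a contradiction. *)
have wgz : dot w (g - z) <= 1 * d.
  apply: dot_le_mul; rewrite ?ler01 ?(ltW d0) // ?w1 ?expr1n //.
  rewrite dotBl !dotBr gg z1 (dotC z g); nra.
have wg : dot v w <= d.
  have := wz ed; move: wgz; rewrite dotBr (dotC w g) gw; lra.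
have ba : b * a <= d.
  by rewrite (le_trans (ler_norm _)) // normrM -[d]mul1r ler_pM.
by move: cv; rewrite dotDr !dotZr -/a; nra.
Qed.

Lemma dot_rotate_by phi x : SO phi ->
  dot (rotate_by phi x) (rotate_by phi x) = dot x x.
Proof. by move=> [oP _]; rewrite /rotate_by dot_mulmx -mulmxA oP mulmx1. Qed.

Lemma normalizeP x : x != 0 ->
  let s := Num.sqrt (dot x x) in 0 < s /\ dot (s^-1 *: x) (s^-1 *: x) = 1.
Proof.
move=> x0 s; have xx : 0 < dot x x by rewrite lt_neqAle eq_sym dot_eq0 x0 dot_ge0.
have s0 : 0 < s by rewrite sqrtr_gt0.
split=> //; rewrite dotZl dotZr mulrA -invfM -expr2 sqr_sqrtr ?(ltW xx) //.
by rewrite mulVf // gt_eqF.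
Qed.

(** The rotation takes the normalized obtuse direction [w] to the direction [u] of the projection of
    [q]. Pulling a cap point [p] back to [v = p *m phi^T] turns [c <= dot p q] into the bound on [v]
    required by [shadow_dot_le]. *)
Lemma exists_fitting_rotation xi q (c d : R) : (3 <= n)%N ->
  dot xi xi = 1 -> dot q q = 1 -> d = (16 * n%:R ^+ 2)^-1 ->
  2 * d < c -> 0 < d <= 1 ->
  exists2 phi, SO_perp xi phi &
    forall p z, dot p p = 1 -> c <= dot p q -> directions z ->
      dot (p *m phi^T - dot (p *m phi^T) xi *: xi) z <= 1 - d ^+ 2 / 2.
Proof.
move=> n3 xi1 q1 dE dc d01.
have [w' [w0 w'xi w'z]] := exists_obtuse_direction n3 _ xi1.
have [s0 w1] := normalizeP _ w0; set s := Num.sqrt _ in s0 w1.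
pose w := s^-1 *: w'.
have wxi : dot w xi = 0 by rewrite dotZl w'xi mulr0.
have [t [u [u1 uxi t01 qE]]] : exists t u,
    [/\ dot u u = 1, dot u xi = 0, 0 <= t <= 1 & q = t *: u + dot q xi *: xi].
  have := dot_shadow q _ xi1; set g := q - _ => gg.
  have [g0|g0] := eqVneq g 0.
    (* If [q] is parallel to [xi], its projection has no direction and any unit vector of [perp xi]
       serves. *)
    exists 0, w; split; rewrite ?lexx ?ler01 // scale0r add0r.
    by apply/eqP; rewrite -subr_eq0 -/g g0.
  have [r0 r1] := normalizeP _ g0; set r := Num.sqrt _ in r0 r1.
  exists r, (r^-1 *: g); split => //.
  - by rewrite dotZl dotBl dotZl xi1 mulr1 subrr mulr0.
  - rewrite (ltW r0) /= -(@ler_sqr _ r) ?nnegrE ?(ltW r0) // expr1n.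
    by rewrite sqr_sqrtr ?dot_ge0 // gg q1 lerBlDr lerDl sqr_ge0.
  - by rewrite scalerA mulfV ?gt_eqF // scale1r subrK.
have [phi phiP wphi] := SO_perp_transitive _ _ _ n3 (etrans u1 (esym w1)) uxi wxi.
have [[oP _] xiP] := phiP.
exists phi => // p z p1 pq zD.
apply: (@shadow_dot_le xi w _ z t (dot q xi) c d) => //.
- by rewrite dot_mulmx trmxK -mulmxA (mulmx1C oP) mulmx1.
- exact: directions_unit.
- rewrite -ler_sqr ?nnegrE // real_normK ?num_real // expr1n.
  by rewrite (le_trans (cauchy_schwarz _ _)) // q1 xi1 mulr1.
- rewrite dE => /(w'z _ zD) le0.
  by rewrite dotZl mulr_ge0_le0 // invr_ge0 ltW.
- rewrite dot_mulmx trmxK mulmxDl -(scalemxAl t) -(scalemxAl (dot q xi)) wphi.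
  by move: xiP; rewrite /rotate_by => ->; rewrite -qE.
Qed.

End Fitting.

(** * From spikes and cap to the bodies *)

Section Bodies.
Context {R : realType} {n : nat}.

(** Duality: rotation and projection move to the other side of the inner product. The projection of
    [b *m phi^T] then lies in [ball_polar h A], against which points of the double polar are
    tested. *)
Lemma projection_fits_section (K L : set 'rV[R]_n) xi phi (h : R)
    (A B : set 'rV[R]_n) : dot xi xi = 1 -> SO_perp xi phi ->
  (forall b, B b -> dot b b = 1) ->
  (forall b a, B b -> A a ->
     dot (b *m phi^T - dot (b *m phi^T) xi *: xi) a <= h) ->
  rotate_by phi @` projection (ball_polar h (ball_polar h A)) xi `<=`
    section (ball_polar h B) xi.
Proof.
move=> xi1 phiP B1 AB _ [_ [x [x1 xA] <-] <-]; have [SOphi xiP] := phiP.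
have [oP _] := SOphi.
split; last first.
  have xiT : xi *m phi^T = xi by rewrite -{1}xiP /rotate_by -mulmxA oP mulmx1.
  rewrite /perp /= /rotate_by dot_mulmx xiT.
  by rewrite dotBl dotZl xi1 mulr1 subrr.
split; first by rewrite dot_rotate_by // dot_shadow // lerBlDr ler_wpDr ?sqr_ge0.
move=> b Bb; rewrite /rotate_by dot_mulmx; set v := b *m phi^T.
have -> : dot (x - dot x xi *: xi) v = dot x (v - dot v xi *: xi).
  by rewrite dotBl dotZl dotBr dotZr (dotC xi) mulrC.
apply: xA; split; last by move=> a; exact: AB.
rewrite dot_shadow // /v {1}dot_mulmx trmxK -mulmxA (mulmx1C oP) mulmx1 B1 //.
by rewrite lerBlDr lerDl sqr_ge0.
Qed.

End Bodies.

(** * Choice of the constants and the two counterexamples *)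

Theorem mainTheorem2 (R : realType) (n : nat) (hn : (3 <= n)%N) :
  (exists K L : set 'rV[R]_n,
     [/\ convex_body K, convex_body L,
         (forall xi, unit_sphere xi ->
            exists2 phi, SO_perp xi phi &
              rotate_by phi @` section K xi `<=` section L xi) &
         ~ (exists2 psi, SO psi & rotate_by psi @` K `<=` L)])
  /\
  (exists K L : set 'rV[R]_n,
     [/\ convex_body K, convex_body L,
         (forall xi, unit_sphere xi ->
            exists2 phi, SO_perp xi phi &
              rotate_by phi @` projection K xi `<=` projection L xi) &
         ~ (exists2 psi, SO psi & rotate_by psi @` K `<=` L)]).
Proof.
have n0 : (0 < n)%N by exact: leq_trans hn.
have N3 : 3 <= n%:R :> R by rewrite (ler_nat _ 3).
have N0 : 0 < n%:R :> R by lra.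
pose q : 'rV[R]_n := delta_mx 0 (Ordinal n0).
(* Here [c] is the bound of [directions_net], [d] the tolerance of [exists_obtuse_direction], and
   [h] the bound of [shadow_dot_le]. *)
pose c : R := (4 * n%:R)^-1; pose d : R := (16 * n%:R ^+ 2)^-1.
pose h : R := 1 - d ^+ 2 / 2.
have q1 : dot q q = 1 by rewrite dot_delta mxE !eqxx.
have d0 : 0 < d by rewrite invr_gt0 mulr_gt0 // exprn_gt0.
have d1 : d <= 1 by rewrite invf_le1 ?mulr_gt0 ?exprn_gt0 //; nra.
have dc : 2 * d < c.
  have -> : c = 4 * n%:R * d by rewrite /c /d; field; rewrite gt_eqF.
  by rewrite ltr_pM2r //; lra.
have h01 : 0 < h <= 1.
  have : d ^+ 2 <= 1 by rewrite expr_le1 // ltW.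
  have := sqr_ge0 d; rewrite /h; lra.
pose Z : set 'rV[R]_n := directions.
pose C : set 'rV[R]_n := [set p | dot p p = 1 /\ c <= dot p q].
pose K := ball_polar h (ball_polar h Z); pose L := ball_polar h C.
have Kbody : convex_body K by apply: convex_body_ball_polar => // a [].
have Lbody : convex_body L by apply: convex_body_ball_polar => // a [->].
have fit xi : unit_sphere xi -> exists2 phi, SO_perp xi phi &
    rotate_by phi @` projection K xi `<=` section L xi.
  move=> xi1; have d01 : 0 < d <= 1 by rewrite d0.
  have [phi phiP H] := exists_fitting_rotation _ _ _ _ hn xi1 q1 erefl dc d01.
  exists phi => //; apply: projection_fits_section => //; first by move=> b [].
  by move=> b z [b1 bq] Zz; exact: H.
have nofit : ~ (exists2 psi, SO psi & rotate_by psi @` K `<=` L).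
  move=> [psi SOpsi KL]; have [oP _] := SOpsi.
  (* Some spike [z] lies in the cap pulled back by [psi]. Its image is a unit vector of [C], and
     testing it against itself in [L] gives [1 <= h]. *)
  have [|z Zz cz] := @directions_net R n hn (q *m psi^T).
    by rewrite dot_mulmx trmxK -mulmxA (mulmx1C oP) mulmx1.
  have z1 : dot z z = 1 by exact: directions_unit.
  have Kz : K z by split; [rewrite z1 | move=> y [_ /(_ z Zz)]; rewrite dotC].
  have [|_ /(_ (rotate_by psi z))] := KL (rotate_by psi z); first by exists z.
  have Cz : C (rotate_by psi z).
    by split; [rewrite dot_rotate_by | rewrite /rotate_by dot_mulmx dotC].
  move=> /(_ Cz); rewrite dot_rotate_by // z1 /h.
  by have := exprn_gt0 2 d0; lra.
split; exists K, L; split => // xi /fit[phi phiP KL]; exists phi => //.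
  (* Points of [perp xi] are their own projections, so a section is contained in the projection. *)
  apply: subset_trans KL => _ [x [Kx xxi] <-]; exists x => //.
  by exists x => //; rewrite xxi scale0r subr0.
move=> y /KL[Ly yxi]; exists y => //.
by rewrite yxi scale0r subr0.
Qed.
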